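(* Let $m\ge3$ be an odd integer, $M=\mathrm{diag}(2,m)$, and $n\in\mathbb{N}$, $n\ge1$. Suppose the anisotropic interpolatory subdivision scheme $\mathcal{S}_{\mathbf{a}_{M,n}}$ of order $n$ and dilation matrix $M$ is convergent. Then $\mathcal{S}_{\mathbf{a}_{M,n}}$ reproduces polynomials up to degree $2n-1$.
   Context: For integers $r\ge2$ and $k\ge1$, the symbol of the univariate $(2k)$-point Dubuc–Deslauriers interpolatory subdivision scheme of dilation $r$ is the Laurent polynomial $$a_{r,k}(z)=1+\sum_{\varepsilon=1}^{r-1}\sum_{\beta=-k+1}^{k}\frac{(-1)^{\beta+k}}{(2k-1)!\,(\varepsilon/r-\beta)}\binom{2k-1}{k-\beta}\Bigl(-k+1-\frac{\varepsilon}{r}\Bigr)_{2k}\,z^{-r\beta+\varepsilon},\qquad z\in\mathbb{C}\setminus\{0\},$$ where $(x)_0=1$ and $(x)_\ell=x(x+1)\cdots(x+\ell-1)$. The anisotropic interpolatory subdivision scheme $\mathcal{S}_{\mathbf{a}_{M,n}}$ of order $n$ and dilation matrix $M=\mathrm{diag}(2,m)$ is defined by its symbol $$a_{M,n}(z_1,z_2)=\sum_{k=0}^{n-1}a_{2,n-k}(z_1)\,a_{m,k+1}(z_2)-\sum_{k=0}^{n-2}a_{2,n-k-1}(z_1)\,a_{m,k+1}(z_2),$$ and its mask $\mathbf{a}_{M,n}$ is given by the coefficients: $a_{M,n}(\mathbf{z})=\sum_{\boldsymbol{\alpha}\in\mathbb{Z}^2}\mathrm{a}_{M,n}(\boldsymbol{\alpha})\,z_1^{\alpha_1}z_2^{\alpha_2}$.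 For a finitely supported real mask $\mathbf{p}$ on $\mathbb{Z}^2$, the subdivision operator with dilation $M$ is $(\mathcal{S}_{\mathbf{p}}\mathbf{c})(\boldsymbol{\alpha})=\sum_{\boldsymbol{\beta}\in\mathbb{Z}^2}\mathrm{p}(\boldsymbol{\alpha}-M\boldsymbol{\beta})\mathrm{c}(\boldsymbol{\beta})$. The scheme is convergent if for every $\mathbf{c}\in\ell^\infty(\mathbb{Z}^2)$ there is a uniformly continuous function $F_{\mathbf{c}}:\mathbb{R}^2\to\mathbb{R}$ with $\lim_{k\to\infty}\sup_{\boldsymbol{\alpha}\in\mathbb{Z}^2}|F_{\mathbf{c}}(M^{-k}\boldsymbol{\alpha})-(\mathcal{S}_{\mathbf{p}}^k\mathbf{c})(\boldsymbol{\alpha})|=0$. The basic limit function is $\phi=F_{\boldsymbol{\delta}}$ with $\boldsymbol{\delta}(\boldsymbol{\alpha})=1$ if $\boldsymbol{\alpha}=\mathbf{0}$ and $0$ otherwise; it is compactly supported. Let $\Pi_N$ be the space of bivariate polynomials of total degree at most $N$. A convergent scheme reproduces polynomials up to degree $N$ (with respect to the parameter values $M^{-k}\boldsymbol{\alpha}$, i.e. shift parameter $\boldsymbol{\tau}=\mathbf{0}$, used for symmetric or interpolatory schemes) if for every $\pi\in\Pi_N$ one has $\sum_{\boldsymbol{\alpha}\in\mathbb{Z}^2}\pi(\boldsymbol{\alpha})\,\phi(\cdot-\boldsymbol{\alpha})=\pi$. *)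

(* Defs.v *)
From mathcomp Require Import all_boot all_order all_algebra.
From mathcomp Require Import all_classical all_reals all_analysis.
From mathcomp Require Import complex.
(* Notations of mpoly clash with those of mathcomp-analysis. *)
From mathcomp Require Import(canonicals,coercions) mpoly.
Set Implicit Arguments.
Unset Strict Implicit.
Unset Printing Implicit Defensive.
Import Order.TTheory GRing.Theory Num.Theory.
Import numFieldNormedType.Exports.
Local Open Scope classical_set_scope.
Local Open Scope ring_scope.

Definition pochhammer (F : fieldType) (x : F) (l : nat) : F :=
  \prod_(i < l) (x + i%:R).

Definition dd_coef (F : fieldType) (r k eps : nat) (beta : int) : F :=
  (-1) ^ (beta + k%:Z)
    / ((2 * k - 1)`!%:R * (eps%:R / r%:R - beta%:~R))
  * 'C(2 * k - 1, `|k%:Z - beta|%N)%:R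
  * pochhammer (- k%:R + 1 - eps%:R / r%:R) (2 * k).

(* The index beta runs over the integers - k + 1, ..., k, written j - k + 1
   with 0 <= j < 2 k; only the values at z != 0 are meaningful. *)
Definition dd_symbol (F : fieldType) (r k : nat) (z : F) : F :=
  1 + \sum_(1 <= eps < r) \sum_(0 <= j < 2 * k)
        let beta := j%:Z - k%:Z + 1 in
        dd_coef F r k eps beta * z ^ (- (r%:Z * beta) + eps%:Z).

Definition aniso_symbol (F : fieldType) (m n : nat) (z1 z2 : F) : F :=
  \sum_(0 <= k < n) dd_symbol 2 (n - k) z1 * dd_symbol m k.+1 z2
  - \sum_(0 <= k < n - 1) dd_symbol 2 (n - k - 1) z1 * dd_symbol m k.+1 z2.

(* Elements of Z^2 and R^2 are column vectors; coordinate 1 is the entry at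
   row 0 and coordinate 2 is the entry at row 1. *)

Definition finitely_supported (R : realType) (p : 'cV[int]_2 -> R) : Prop :=
  finite_set [set alpha | p alpha != 0].

(* Sums \sum_(_ \in _) range over the finite support of the summand. *)
Definition is_mask_of (R : realType) (s : R[i] -> R[i] -> R[i])
    (p : 'cV[int]_2 -> R) : Prop :=
  finitely_supported p /\
  forall z1 z2 : R[i], z1 != 0 -> z2 != 0 ->
    s z1 z2 = \sum_(alpha \in [set: 'cV[int]_2])
      ((p alpha)%:C)%C * z1 ^ (alpha 0 0) * z2 ^ (alpha 1 0).

Definition dilation (m : nat) : 'M[int]_2 :=
  diag_mx (\row_(i < 2) if i == 0 then 2%:Z else m%:Z).

Definition subdivision (R : realType) (M : 'M[int]_2) (p : 'cV[int]_2 -> R)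
    (c : 'cV[int]_2 -> R) (alpha : 'cV[int]_2) : R :=
  \sum_(beta \in [set: 'cV[int]_2]) p (alpha - M *m beta) * c beta.

(* The parameter value M^-k alpha in R^2. *)
Definition param (R : realType) (M : 'M[int]_2) (k : nat)
    (alpha : 'cV[int]_2) : 'cV[R]_2 :=
  invmx (map_mx intr M) ^+ k *m map_mx intr alpha.

Definition is_limit_function (R : realType) (M : 'M[int]_2)
    (p c : 'cV[int]_2 -> R) (F : 'cV[R]_2 -> R) : Prop :=
  unif_continuous F /\
  ereal_sup [set (`|F (param R M k alpha)
                    - iter k (subdivision M p) c alpha|)%:E
              | alpha in [set: 'cV[int]_2]] @[k --> \oo] --> 0%E.

Definition convergent (R : realType) (M : 'M[int]_2)
    (p : 'cV[int]_2 -> R) : Prop :=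
  forall c : 'cV[int]_2 -> R,
    (exists B : R, forall alpha, `|c alpha| <= B) ->
    exists F : 'cV[R]_2 -> R, is_limit_function M p c F.

Definition delta_seq (R : realType) (alpha : 'cV[int]_2) : R :=
  (alpha == 0)%:R.

(* For a convergent scheme the limit function is unique when M is expanding;
   the default value 0 is irrelevant there. *)
Definition basic_limit_function (R : realType) (M : 'M[int]_2)
    (p : 'cV[int]_2 -> R) : 'cV[R]_2 -> R :=
  xget (fun=> 0) [set F | is_limit_function M p (@delta_seq R) F].

(* mpoly.msize is the total degree plus one, and 0 for the zero polynomial.
   The sum is locally finite because the basic limit function is compactly
   supported. *)
Definition reproduces_polynomials (R : realType) (M : 'M[int]_2)
    (p : 'cV[int]_2 -> R) (N : nat) : Prop :=
  forall q : mpoly.mpoly 2 R, (mpoly.msize q <= N.+1)%N ->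
  forall x : 'cV[R]_2,
    \sum_(alpha \in [set: 'cV[int]_2])
       mpoly.meval (fun i => (alpha i 0)%:~R) q
       * basic_limit_function M p (x - map_mx intr alpha)
    = mpoly.meval (fun i => x i 0) q.

(* Main.v *)
Require Import Defs.
From mathcomp Require Import all_boot all_order all_algebra.
From mathcomp Require Import all_classical all_reals all_analysis.
From mathcomp Require Import complex finmap.
From mathcomp Require Import(canonicals,coercions) mpoly.
From mathcomp Require Import ring lra zify.
Set Implicit Arguments.
Unset Strict Implicit.
Unset Printing Implicit Defensive.
Import Order.TTheory GRing.Theory Num.Theory.
Import numFieldNormedType.Exports.
Local Open Scope classical_set_scope.
Local Open Scope ring_scope.

(** The symbol is built so that one step of the scheme reproduces polynomials
    exactly, and convergence transports this to the basic limit function.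

    Univariate step.  The coefficients of [a_(r,k)] at the exponents
    [eps - r beta] are the values at [eps / r] of the Lagrange basis for the nodes
    [-k + 1, ..., k] ([dd_coef_lagrange]); hence the scheme maps the samples of
    [t ^ e] on the integers to its samples on the integers over [r] whenever
    [e < 2 k] ([dd_functional_coset_power]).

    Bivariate step.  On [t1 ^ e0 t2 ^ e1] with [e0 + e1 < 2 n], each difference
    [a_(2,n-k) (a_(m,k+1) - a_(m,k))] of the symbol either vanishes (if
    [e1 < 2 k]) or has an exact first factor (if [e1 >= 2 k], because then
    [e0 < 2 (n - k)]), and the sum telescopes to the exact value ([aniso_functional_coset_power]).  The mask is
    given by its symbol as a function of [z1] and [z2]; since a Laurent polynomial
    that vanishes on all nonzero numbers has zero coefficients, the powers of [z1]
    and [z2] may be replaced by arbitrary functions of the exponents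
    ([laurent_dual_unique], [mask_aniso_functional]).  This gives
    [mask_reproduces].

    Limit.  Let [p_k] be the [k]-th iterate of the delta sequence.  By induction
    [\sum_be p_k (al - M ^ k be) q be = q (M ^ -k al)] for polynomials [q] of degree
    less than [2 n] ([cascade_reproduces]).  Given [x], take [al_k] with
    [M ^ -k al_k] tending to [x].  Then [p_k (al_k - M ^ k be)] tends to
    [phi (x - be)] ([cascade_cvg]), and only the [be] in a box independent of [k]
    contribute, because the supports of the [p_k] grow no faster than [M ^ k]
    ([cascade_support], [cascade_floor_support]).  The sum is thus a fixed finite
    one, and its limit is [\sum_be q be phi (x - be) = q x]. *)

(** * The Dubuc-Deslauriers coefficients are Lagrange basis values *)

Lemma prod_node_diff (F : comPzRingType) (j t : nat) :
  \prod_(l < j.+1 + t | l != j :> nat) (j%:R - l%:R)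
  = (-1) ^+ t * j`!%:R * t`!%:R :> F.
Proof.
elim: t => [|t IH].
  rewrite addn0 big_mkcond big_ord_recr /= eqxx /= mulr1.
  rewrite expr0 mul1r mulr1 fact_prod big_add1 /= big_mkord natr_prod.
  rewrite [RHS](reindex_inj rev_ord_inj) /=; apply: eq_bigr => l _.
  have lj := ltn_ord l.
  by rewrite (ltn_eqF lj) /= -natrB 1?ltnW // subnSK.
rewrite addnS big_mkcond big_ord_recr -big_mkcond /= IH.
rewrite ifT; last by apply/eqP; lia.
by rewrite factS exprS natrM !natrD; ring.
Qed.

(** The Pochhammer symbol is the full node polynomial at [eps / r]: with [2 k]
    factors the sign of [node - x] against [x - node] cancels.  Dividing by
    [x - node_j] leaves the numerator of the [j]-th Lagrange polynomial, and
    the binomial over [(2 k - 1)!] is, up to sign, the inverse of its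
    denominator, a product of differences of integer nodes. *)
Lemma dd_coef_lagrange (F : numFieldType) (r k eps : nat) (j : 'I_(2 * k)) :
  (0 < eps < r)%N ->
  dd_coef F r k eps (j%:Z - k%:Z + 1)
  = (tnth (lagrange (2 * k) (fun l : nat => l%:R - k%:R + 1 : F)) j)
      .[eps%:R / r%:R].
Proof.
move=> /andP[e0 er].
have k0 : (0 < k)%N by case: k j => // -[[]].
have r0 : r%:R != 0 :> F by rewrite pnatr_eq0; lia.
set x := _ / _.
(* The evaluation point is not an integer, so it differs from all nodes. *)
have xN l : x - (l%:R - k%:R + 1) != 0.
  apply/eqP => /(congr1 (fun z => z * r%:R)).
  rewrite mulrBl divfK // mul0r => /eqP; rewrite subr_eq0 => /eqP h.
  have : eps%:Z = (l%:Z - k%:Z + 1) * r%:Z.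
    apply: (@intr_inj F); rewrite rmorphM rmorphD rmorphB /=.
    by rewrite -!pmulrn h.
  move: (_ - _ + 1) => t ht; case: (lerP t 0) => t0;
    by move: er e0; clear -ht t0; nia.
rewrite lagrangeE ?muln_gt0 //; last first.
  by move=> a b /addIr/addIr/eqP; rewrite eqr_nat => /eqP.
rewrite /= hornerM hornerC !horner_prod.
under eq_bigr do rewrite hornerXsubC.
under [X in _ = _ * X]eq_bigr do rewrite hornerXsubC.
rewrite (_ : \prod_(i < 2 * k | _) _ =
   (-1) ^+ (2 * k - j.+1) * j`!%:R * (2 * k - j.+1)`!%:R); last first.
  rewrite -prod_node_diff subnKC //.
  by apply: eq_big => [i|i _]; [rewrite -val_eqE | ring].
rewrite /dd_coef /pochhammer.
rewrite (_ : `|k%:Z - _|%N = 2 * k - 1 - j)%N; last by have := ltn_ord j; lia.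
rewrite (_ : j%:Z - k%:Z + 1 + k%:Z = j.+1%:Z); last by lia.
rewrite (_ : \prod_(i < 2 * k) _ = (x - (j%:R - k%:R + 1)) *
     \prod_(i < 2 * k | i != j) (x - (i%:R - k%:R + 1))); last first.
  rewrite -[RHS](bigD1 j (P := xpredT)
    (F := fun i : 'I_(2 * k) => x - (i%:R - k%:R + 1))) //=.
  transitivity (\prod_(i < 2 * k) (-1 * (x - (i%:R - k%:R + 1)))).
    by apply: eq_bigr => i _; rewrite /x; ring.
  by rewrite big_split /= prodr_const card_ord exprM sqrrN !expr1n mul1r.
rewrite rmorphD rmorphB /= -!pmulrn.
move: (xN j); set y := x - _ => y0; set P := \prod_(_ < _ | _) _.
rewrite (_ : 2 * k - j.+1 = 2 * k - 1 - j)%N; last by lia.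
have jk : (j <= 2 * k - 1)%N by have := ltn_ord j; lia.
have /(congr1 (fun n => n%:R : F)) := bin_fact jk.
rewrite -bin_sub // !natrM => <-.
have -> : (-1) ^ j.+1 = (-1) ^+ (2 * k - 1 - j) :> F.
  have e : odd (2 * k - 1 - j) = odd j.+1.
    by rewrite -subnDA oddB ?oddM //=; lia.
  by rewrite -(signr_odd _ (_ - _)) e signr_odd.
have f1 : j`!%:R != 0 :> F by rewrite pnatr_eq0 -lt0n fact_gt0.
have f2 : (2 * k - 1 - j)`!%:R != 0 :> F by rewrite pnatr_eq0 -lt0n fact_gt0.
have f3 : 'C(2 * k - 1, 2 * k - 1 - j)%:R != 0 :> F.
  by rewrite pnatr_eq0 -lt0n bin_gt0 leq_subr.
have := sqrr_sign F (2 * k - 1 - j).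
set s := (-1) ^+ _ => s2.
have s0 : s != 0 by rewrite /s signr_eq0.
have sV : s^-1 = s by apply: (mulfI s0); rewrite mulfV // -expr2.
rewrite !invfM sV.
by field; rewrite f1 f2 f3 y0.
Qed.

(** * Polynomial reproduction by the univariate masks *)

(** The coefficients of [dd_symbol r k], paired with an arbitrary function of
    the exponent instead of [fun e => z ^ e]. *)
Definition dd_functional (F : fieldType) (r k : nat) (f : int -> F) : F :=
  f 0 + \sum_(1 <= eps < r) \sum_(0 <= j < 2 * k)
          let beta := j%:Z - k%:Z + 1 in
          dd_coef F r k eps beta * f (- (r%:Z * beta) + eps%:Z).

(** As a function of the mask index [s], the factor that the datum
    [gamma |-> gamma ^ e] contributes in [\sum_gamma p (x - d gamma) gamma ^ e]
    when the sum is reindexed by [s = x - d gamma]. *)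
Definition coset_power (F : pzRingType) (d : nat) (x : int) (e : nat)
    (s : int) : F :=
  if (d %| x - s)%Z then (((x - s) %/ d)%Z)%:~R ^+ e else 0.

(** Writing both arguments in mixed form, residue plus multiple of [d], makes
    every index of [dd_symbol] (including the exponent 0 of the constant term,
    with [b = 0] and [v = 0]) an instance of one formula. *)
Lemma coset_power_split (F : pzRingType) (d : nat) (q b : int) (u v e : nat) :
  (u < d)%N -> (v < d)%N ->
  coset_power F d (q * d%:Z + u%:Z) e (- (d%:Z * b) + v%:Z)
  = (u == v)%:R * (q + b)%:~R ^+ e.
Proof.
move=> ud vd; rewrite /coset_power.
have d0 : d%:Z != 0 by lia.
have -> : q * d%:Z + u%:Z - (- (d%:Z * b) + v%:Z)
          = (q + b) * d%:Z + (u%:Z - v%:Z) by ring.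
have [->|uv] := eqVneq u v.
  by rewrite subrr addr0 dvdz_mull // mulzK // mul1r.
rewrite rpredDl ?dvdz_mull // mul0r.
case: ifP => // /dvdzP[t ht]; exfalso.
have [t0|t0] := lerP t 0; last by nia.
have [t1|t1] := lerP 0 t; last by nia.
have t00 : t = 0 by lia.
by move: ht; rewrite t00 mul0r => /eqP; rewrite subr_eq0 eqz_nat (negPf uv).
Qed.

(** Only the residue class of [x] modulo [r] contributes.  If [x = q r], this is
    the constant term of the symbol, which returns [q ^ e].  Otherwise it is
    the Lagrange interpolant of [(q + X) ^ e] at [u / r], exact because the
    degree [e] is smaller than the number [2 k] of nodes. *)
Lemma dd_functional_coset_power (F : numFieldType) (r k e : nat) (x : int) :
  (0 < r)%N -> (e < 2 * k)%N ->
  dd_functional r k (coset_power F r x e) = (x%:~R / r%:R) ^+ e.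
Proof.
move=> r0 ek; have rz : r%:Z != 0 by lia.
have rF : r%:R != 0 :> F by rewrite pnatr_eq0 -lt0n.
have [u ur ->] : exists2 u : nat, (u < r)%N & x = (x %/ r)%Z * r%:Z + u%:Z.
  exists `|(x %% r)%Z|%N.
    by have := ltz_pmod x (d := r); have := modz_ge0 x rz; lia.
  by rewrite {1}(divz_eq x r) gez0_abs ?modz_ge0.
move: (x %/ r)%Z => q; rewrite /dd_functional.
rewrite -[X in coset_power _ _ _ _ X + _](_ : - (r%:Z * 0) + 0%:Z = 0);
  last by rewrite mulr0.
rewrite coset_power_split // addr0.
under eq_big_nat => v /andP[_ vr].
  under eq_bigr do rewrite /= coset_power_split // mulrCA.
  rewrite -mulr_sumr; over.
have [u0|u0] := posnP u.
  rewrite u0 mul1r addr0 big_nat_cond big1 ?addr0; last first.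
    by case=> // v _; rewrite mul0r.
  by rewrite rmorphM /= -pmulrn mulfK.
rewrite mul0r add0r (bigD1_seq u) ?mem_index_iota ?iota_uniq ?u0 //=.
rewrite eqxx mul1r [X in _ + X]big1 ?addr0; last first.
  by move=> v; rewrite eq_sym => /negPf ->; rewrite mul0r.
pose y (l : nat) : F := l%:R - k%:R + 1.
pose p : {poly F} := ((q%:~R)%:P + 'X) ^+ e.
have y_inj : injective y.
  by move=> a b /addIr/addIr/eqP; rewrite eqr_nat => /eqP.
have sp : (size p <= 2 * k)%N.
  apply: leq_trans (size_poly_exp_leq _ _) _.
  by rewrite addrC size_XaddC mul1n.
have k0 : (0 < 2 * k)%N by apply: leq_trans ek.
have := congr1 (fun p => p.[u%:R / r%:R]) (lagrange_gen k0 y_inj sp).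
rewrite {1}/p !hornerE rmorphD rmorphM /= -!pmulrn mulrDl mulfK // => ->.
rewrite horner_sum big_mkord; apply: eq_bigr => j _.
rewrite dd_coef_lagrange ?u0 // hornerM hornerC mulrC; congr (_ * _).
by rewrite /p /y !hornerE !rmorphD rmorphN /= -!pmulrn.
Qed.

(** * From identities of symbols to identities of masks *)

(** [h] is a Laurent polynomial on the nonzero elements, and [L] applies its
    coefficients to an arbitrary function of the exponent.  The list of terms is
    existential so that closure under the ring operations needs no normal form. *)
Definition laurent_dual (F : fieldType) (h : F -> F)
    (L : (int -> F) -> F) : Prop :=
  exists s : seq (F * int),
    (forall z, z != 0 -> h z = \sum_(t <- s) t.1 * z ^ t.2) /\
    (forall f, L f = \sum_(t <- s) t.1 * f t.2).

Lemma laurent_dual_monomial (F : fieldType) (e : int) :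
  laurent_dual (fun z : F => z ^ e) (fun f => f e).
Proof. by exists [:: (1, e)]; split => [z _|f]; rewrite big_seq1 mul1r. Qed.

Lemma laurent_dualD (F : fieldType) (h h' : F -> F) L L' :
  laurent_dual h L -> laurent_dual h' L' ->
  laurent_dual (fun z => h z + h' z) (fun f => L f + L' f).
Proof.
move=> [s [hs Ls]] [s' [hs' Ls']]; exists (s ++ s').
by split => [z z0|f]; rewrite big_cat ?hs ?hs' ?Ls ?Ls'.
Qed.

Lemma laurent_dualZ (F : fieldType) (c : F) (h : F -> F) L :
  laurent_dual h L -> laurent_dual (fun z => c * h z) (fun f => c * L f).
Proof.
move=> [s [hs Ls]]; exists [seq (c * t.1, t.2) | t <- s].
by split => [z z0|f]; rewrite big_map ?hs ?Ls // mulr_sumr;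
  apply: eq_bigr => t _; rewrite mulrA.
Qed.

Lemma laurent_dualB (F : fieldType) (h h' : F -> F) L L' :
  laurent_dual h L -> laurent_dual h' L' ->
  laurent_dual (fun z => h z - h' z) (fun f => L f - L' f).
Proof.
move=> hL /(laurent_dualZ (-1)) /(laurent_dualD hL) [s [hs Ls]].
by exists s; split => [z z0|f]; rewrite -?hs -?Ls // mulN1r.
Qed.

Lemma laurent_dual_sum (F : fieldType) (I : Type) (r : seq I)
    (h : I -> F -> F) (L : I -> (int -> F) -> F) :
  (forall i, laurent_dual (h i) (L i)) ->
  laurent_dual (fun z => \sum_(i <- r) h i z) (fun f => \sum_(i <- r) L i f).
Proof.
move=> hL; elim: r => [|i r [s [hs Ls]]].
  by exists [::]; split => *; rewrite !big_nil.
have [s' [hs' Ls']] := hL i; exists (s' ++ s).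
by split => [z z0|f]; rewrite big_cons big_cat /= ?hs ?Ls ?hs' ?Ls'.
Qed.

(** Multiplying by a power of [z] turns the Laurent polynomial into a polynomial
    vanishing at all positive integers, hence zero; the conclusion regroups the
    terms by exponent, where each coefficient is one of that polynomial. *)
Lemma laurent_eq0 (F : numFieldType) (s : seq (F * int)) (f : int -> F) :
  (forall z, z != 0 -> \sum_(t <- s) t.1 * z ^ t.2 = 0) ->
  \sum_(t <- s) t.1 * f t.2 = 0.
Proof.
move=> s0; pose N := \max_(t <- s) `|t.2|%N.
have sN (t : F * int) : t \in s ->
    (0 <= t.2 + N%:Z) /\ (`|(t.2 + N%:Z)%R|%N < (2 * N).+1)%N.
  move=> ts; have : (`|t.2| <= N)%N by apply: leq_bigmax_seq.
  by lia.
pose p : {poly F} := \sum_(t <- s) t.1 *: 'X^`|(t.2 + N%:Z)%R|%N.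
have p0 : p = 0.
  pose rs : seq F := [seq l.+1%:R | l <- iota 0 (size p)].
  apply: (@roots_geq_poly_eq0 _ _ rs); last by rewrite size_map size_iota.
  - apply/allP => _ /mapP[l _ ->].
    have z0 : l.+1%:R != 0 :> F by rewrite pnatr_eq0.
    rewrite rootE /p horner_sum; apply/eqP.
    transitivity (l.+1%:R ^ N%:Z * \sum_(t <- s) t.1 * l.+1%:R ^ t.2 : F).
      rewrite mulr_sumr !big_seq; apply: eq_bigr => t /sN[tN _].
      by rewrite hornerZ hornerXn exprnP gez0_abs // expfzDr //; ring.
    by rewrite s0 ?mulr0.
  - rewrite map_inj_uniq ?iota_uniq // => l l' /eqP.
    by rewrite eqr_nat => /eqP[].
transitivity (\sum_(c < (2 * N).+1) p`_c * f (c%:Z - N%:Z)); last first.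
  by rewrite big1 // => c _; rewrite p0 coef0 mul0r.
under [RHS]eq_bigr do rewrite /p coef_sum mulr_suml.
rewrite exchange_big /= !big_seq; apply: eq_bigr => t /sN[t0 tN].
rewrite (bigD1 (Ordinal tN)) //= coefZ coefXn eqxx mulr1 gez0_abs // addrK.
rewrite big1 ?addr0 // => c; rewrite -val_eqE /= => /negPf cN.
by rewrite coefZ coefXn cN mulr0 mul0r.
Qed.

(** The functional depends on the values of the symbol only, which is what lets
    the mask be known through its symbol alone. *)
Lemma laurent_dual_unique (F : numFieldType) (h h' : F -> F) L L' f :
  laurent_dual h L -> laurent_dual h' L' ->
  (forall z, z != 0 -> h z = h' z) -> L f = L' f.
Proof.
move=> hL hL' hh'; have [s [hs Ls]] := laurent_dualB hL hL'.
apply/eqP; rewrite -subr_eq0 Ls; apply/eqP/laurent_eq0 => z z0.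
by rewrite -hs // hh' // subrr.
Qed.

Lemma laurent_dual_dd_symbol (F : fieldType) (r k : nat) :
  laurent_dual (@dd_symbol F r k) (@dd_functional F r k).
Proof.
rewrite /dd_symbol /dd_functional.
have H : laurent_dual (fun z : F => z ^ 0 +
     \sum_(1 <= eps < r) \sum_(0 <= j < 2 * k)
       dd_coef F r k eps (j%:Z - k%:Z + 1)
       * z ^ (- (r%:Z * (j%:Z - k%:Z + 1)) + eps%:Z))
   (@dd_functional F r k).
  apply: (laurent_dualD (laurent_dual_monomial F 0)).
  do 2![apply: laurent_dual_sum => ?].
  exact/laurent_dualZ/laurent_dual_monomial.
by have [s [hs Ls]] := H; exists s; split => // z z0; rewrite -hs ?expr0z.
Qed.

Definition aniso_functional (F : fieldType) (m n : nat) (f g : int -> F) : F :=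
  \sum_(0 <= k < n) dd_functional 2 (n - k) f * dd_functional m k.+1 g
  - \sum_(0 <= k < n - 1)
      dd_functional 2 (n - k - 1) f * dd_functional m k.+1 g.

(** Uniqueness is used one variable at a time: with [z2] fixed, powers of [z1]
    are replaced by [f]; the result is a Laurent polynomial in [z2], whose powers
    are then replaced by [g].  Product functions [f (x) g] are enough for
    monomial data. *)
Lemma mask_aniso_functional (R : realType) (m n : nat) (a : 'cV[int]_2 -> R)
    (A : {fset 'cV[int]_2}) (f g : int -> R[i]) :
  (forall alpha, alpha \notin A -> a alpha = 0) ->
  is_mask_of (@aniso_symbol (complex R) m n) a ->
  \sum_(alpha <- A) ((a alpha)%:C)%C * f (alpha 0 0) * g (alpha 1 0)
  = aniso_functional m n f g.
Proof.
move=> aA [_ ha].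
have {}ha z1 z2 : z1 != 0 -> z2 != 0 -> aniso_symbol m n z1 z2 =
    \sum_(alpha <- A) ((a alpha)%:C)%C * z1 ^ alpha 0 0 * z2 ^ alpha 1 0.
  by move=> z10 z20; rewrite ha // (fsbigTE A) // => al /aA ->; rewrite !mul0r.
pose L f' g' :=
  \sum_(alpha <- A) ((a alpha)%:C)%C * f' (alpha 0 0) * g' (alpha 1 0).
have dualr (c : R[i]) h M : laurent_dual h M ->
    laurent_dual (fun z => h z * c) (fun f => M f * c).
  move=> /(laurent_dualZ c)[s [hs Ms]].
  by exists s; split => *; rewrite mulrC ?hs ?Ms.
have step z2 : z2 != 0 -> L f (fun e => z2 ^ e) =
    \sum_(0 <= k < n) dd_functional 2 (n - k) f * dd_symbol m k.+1 z2
  - \sum_(0 <= k < n - 1) dd_functional 2 (n - k - 1) f * dd_symbol m k.+1 z2.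
  move=> z20; pose M f' :=
    \sum_(0 <= k < n) dd_functional 2 (n - k) f' * dd_symbol m k.+1 z2
  - \sum_(0 <= k < n - 1) dd_functional 2 (n - k - 1) f' * dd_symbol m k.+1 z2.
  apply: (@laurent_dual_unique _ _ _ (L ^~ (fun e => z2 ^ e)) M f _ _
    (fun z z0 => esym (ha z z2 z0 z20))).
    apply: laurent_dual_sum => al.
    exact/dualr/laurent_dualZ/laurent_dual_monomial.
  by apply: laurent_dualB; apply: laurent_dual_sum => k;
    apply/dualr/laurent_dual_dd_symbol.
apply: (@laurent_dual_unique _ _ _ (L f) (aniso_functional m n f) g _ _ step).
  by apply: laurent_dual_sum => al; apply/laurent_dualZ/laurent_dual_monomial.
by apply: laurent_dualB; apply: laurent_dual_sum => k;
  apply/laurent_dualZ/laurent_dual_dd_symbol.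
Qed.

(** Group the two sums of the symbol as the first product plus the terms
    [a_(2,n-k) (a_(m,k+1) - a_(m,k))], [1 <= k < n].  If [e1 < 2 k] the second
    factor vanishes on the data; if not, [e0 < 2 (n - k)] and the first factor is
    exact.  So in all cases the first factor may be replaced by its exact value,
    and the sum telescopes to [a_(m,n)], exact on degree [e1 < 2 n]. *)
Lemma aniso_functional_coset_power (F : numFieldType) (m n e0 e1 : nat)
    (x y : int) :
  (0 < m)%N -> (e0 + e1 < 2 * n)%N ->
  aniso_functional m n (coset_power F 2 x e0) (coset_power F m y e1)
  = (x%:~R / 2) ^+ e0 * (y%:~R / m%:R) ^+ e1.
Proof.
move=> m0 en; rewrite /aniso_functional.
case: n en => [|n en]; first by rewrite muln0.
rewrite big_nat_recl // subn1 /= -addrA -sumrB.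
rewrite dd_functional_coset_power //; last by lia.
set f := coset_power F 2 x e0; set g := coset_power F m y e1.
transitivity ((x%:~R / 2) ^+ e0 * dd_functional m 1 g + (x%:~R / 2) ^+ e0 *
   \sum_(0 <= k < n) (dd_functional m k.+2 g - dd_functional m k.+1 g)).
  congr (_ + _); rewrite mulr_sumr; apply: eq_big_nat => k /andP[_ kn].
  rewrite subSS (_ : n.+1 - k - 1 = n - k)%N; last by lia.
  rewrite -mulrBr; have [e1k|e1k] := ltnP e1 (2 * k.+1).
    have gE l : (e1 < 2 * l)%N -> dd_functional m l g = (y%:~R / m%:R) ^+ e1.
      exact: dd_functional_coset_power.
    by rewrite !gE ?subrr ?mulr0 //; lia.
  by rewrite dd_functional_coset_power //; lia.
rewrite -mulrDr telescope_sumr // addrC subrK.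
by rewrite dd_functional_coset_power //; lia.
Qed.

(** * Coordinates of the dilation and boxes in the lattice *)

Definition axis_dilation (m : nat) (i : 'I_2) : nat := if i == 0 then 2 else m.

Lemma axis_dilation_gt1 (m : nat) (i : 'I_2) :
  (1 < m)%N -> (1 < axis_dilation m i)%N.
Proof. by rewrite /axis_dilation; case: ifP. Qed.

Lemma axis_dilation_gt0 (m : nat) (i : 'I_2) :
  (0 < m)%N -> (0 < axis_dilation m i)%N.
Proof. by rewrite /axis_dilation; case: ifP. Qed.

Lemma diag_mx_expE (K : pzSemiRingType) (p : nat) (d : 'rV[K]_p.+1) (k : nat)
    (v : 'cV[K]_p.+1) (i : 'I_p.+1) :
  (diag_mx d ^+ k *m v) i 0 = d 0 i ^+ k * v i 0.
Proof.
elim: k v => [|k IH] v; first by rewrite !expr0 mul1r mul1mx.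
by rewrite exprSr -mulmxA IH mul_diag_mx mxE mulrA exprSr.
Qed.

Lemma dilation_expE (m k : nat) (v : 'cV[int]_2) (i : 'I_2) :
  (dilation m ^+ k *m v) i 0 = (axis_dilation m i)%:Z ^+ k * v i 0.
Proof.
rewrite diag_mx_expE mxE /axis_dilation; congr (_ ^+ _ * _).
by case: ifP.
Qed.

Lemma dilationE (m : nat) (v : 'cV[int]_2) (i : 'I_2) :
  (dilation m *m v) i 0 = (axis_dilation m i)%:Z * v i 0.
Proof. by rewrite -[dilation m]expr1 dilation_expE expr1. Qed.

Lemma paramE (R : realType) (m k : nat) (v : 'cV[int]_2) (i : 'I_2) :
  (0 < m)%N ->
  param R (dilation m) k v i 0 = (v i 0)%:~R / (axis_dilation m i)%:R ^+ k.
Proof.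
move=> m0; pose d : 'rV[R]_2 := \row_i (axis_dilation m i)%:R.
have d0 j : d 0 j != 0.
  by rewrite mxE pnatr_eq0 -lt0n axis_dilation_gt0.
have -> : param R (dilation m) k v =
    diag_mx (\row_i (d 0 i)^-1) ^+ k *m map_mx intr v.
  rewrite /param; congr (_ ^+ _ *m _).
  have -> : map_mx intr (dilation m) = diag_mx d.
    apply/matrixP => i' j; rewrite !mxE /axis_dilation.
    by case: (i' == j); rewrite ?mulr1n ?mulr0n //; case: ifP.
  have dd : diag_mx d *m diag_mx (\row_i (d 0 i)^-1) = 1%:M.
    rewrite mulmx_diag; apply/matrixP => i' j; rewrite !mxE.
    by have := d0 i'; rewrite !mxE => h; rewrite mulfV.
  have [ud _] := mulmx1_unit dd.
  by rewrite -[LHS]mulmx1 -dd mulmxA mulVmx // mul1mx.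
by rewrite diag_mx_expE !mxE exprVn mulrC.
Qed.

Definition box (N : nat) : {fset 'cV[int]_2} :=
  fset_set [set v : 'cV[int]_2 | forall i, (`|(v i 0)%R| <= N)%N].

Lemma in_box (N : nat) (v : 'cV[int]_2) :
  reflect (forall i, (`|(v i 0)%R| <= N)%N) (v \in box N).
Proof.
suff fin : finite_set [set v : 'cV[int]_2 | forall i, (`|(v i 0)%R| <= N)%N].
  rewrite /box in_fset_set //.
  by apply: (iffP idP) => [/set_mem|] //; exact: mem_set.
pose h (f : {ffun 'I_2 -> 'I_(2 * N).+1}) : 'cV[int]_2 :=
  \col_i ((f i)%:Z - N%:Z).
apply: (@sub_finite_set _ _ (h @` setT)); last first.
  by apply: finite_image; apply: finite_finset.
move=> w wN; exists [ffun i => inord `|(w i 0 + N%:Z)%R|%N] => //.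
apply/colP => i; rewrite !mxE ffunE.
have := wN i => /= wi.
by rewrite inordK; lia.
Qed.


Definition l1norm (v : 'cV[int]_2) : nat := \sum_i `|(v i 0)%R|%N.

Lemma coord_le_l1norm (v : 'cV[int]_2) (i : 'I_2) : (`|(v i 0)%R| <= l1norm v)%N.
Proof. by rewrite /l1norm (bigD1 i) //= leq_addr. Qed.

Definition supported_in (R : nmodType) (N : nat) (f : 'cV[int]_2 -> R) : Prop :=
  forall v, v \notin box N -> f v = 0.

Lemma finitely_supported_in_box (R : realType) (a : 'cV[int]_2 -> R) :
  finitely_supported a -> exists L, supported_in L a.
Proof.
move=> fin; pose A := fset_set [set v | a v != 0].
exists (\max_(v <- A) l1norm v) => v.
apply: contraNeq => av; apply/in_box => i.
have vA : v \in A by rewrite in_fset_set //; apply: mem_set.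
apply: leq_trans (coord_le_l1norm v i) _.
by apply: leq_bigmax_seq.
Qed.

Lemma sub_dilation_expE (m k : nat) (x y : 'cV[int]_2) (i : 'I_2) :
  (x - dilation m ^+ k *m y) i 0
  = x i 0 - (axis_dilation m i)%:Z ^+ k * y i 0.
Proof. by rewrite mxE [X in _ + X]mxE dilation_expE. Qed.

Lemma sub_dilationE (m : nat) (x y : 'cV[int]_2) (i : 'I_2) :
  (x - dilation m *m y) i 0 = x i 0 - (axis_dilation m i)%:Z * y i 0.
Proof. by rewrite -[dilation m]expr1 sub_dilation_expE expr1. Qed.

(** A fixed [x] and a function supported in a box leave only finitely many
    shifts [x - M ^ k y] to consider, the dilation being at least one on each
    axis. *)
Lemma dilate_notin_box (m k L N : nat) (x y : 'cV[int]_2) :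
  (0 < m)%N -> (l1norm x + L <= N)%N -> y \notin box N ->
  x - dilation m ^+ k *m y \notin box L.
Proof.
move=> m0 xN; apply: contra => /in_box h; apply/in_box => i.
have := h i; rewrite sub_dilation_expE.
have := coord_le_l1norm x i.
have := axis_dilation_gt0 i m0.
set d := axis_dilation m i => d0 xi hi.
have : (`|(y i 0)%R| <= `|((d%:Z ^+ k) * y i 0)%R|)%N.
  by rewrite abszM leq_pmull // absz_gt0 expf_neq0 //; lia.
by move: hi; set t := _ * _; lia.
Qed.

(** * Polynomial reproduction by the bivariate mask *)

(** One subdivision step maps the samples of a monomial on the lattice to its
    samples on the refined lattice.  Reindexing the sum over [ga] by the mask
    index [s = al - M ga], which ranges over one coset of [M Z^2], turns it into
    the pairing of the mask with a product of two [coset_power]s. *)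
Lemma mask_reproduces (R : realType) (m n : nat) (a : 'cV[int]_2 -> R)
    (e : 'I_2 -> nat) (al : 'cV[int]_2) :
  (0 < m)%N -> is_mask_of (@aniso_symbol (complex R) m n) a ->
  (\sum_i e i < 2 * n)%N ->
  \sum_(ga \in [set: 'cV[int]_2])
      a (al - dilation m *m ga) * \prod_i ((ga i 0)%:~R : R) ^+ e i
  = \prod_i ((al i 0)%:~R / (axis_dilation m i)%:R) ^+ e i.
Proof.
move=> m0 ma en; have [L aL] := finitely_supported_in_box (proj1 ma).
pose G := box (l1norm al + L).
have aG ga : ga \notin G -> a (al - dilation m *m ga) = 0.
  move=> gaG; apply: aL; rewrite -[dilation m]expr1.
  exact: dilate_notin_box gaG.
rewrite (fsbigTE G) => [|ga /aG ->]; last by rewrite mul0r.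
have ord1E : lift ord0 (@ord0 0) = 1 :> 'I_2 by exact: val_inj.
apply: complexI; rewrite rmorph_sum rmorph_prod /=.
pose f := coset_power R[i] 2 (al 0 0) (e 0).
pose g := coset_power R[i] m (al 1 0) (e 1).
transitivity (aniso_functional m n f g); last first.
  rewrite aniso_functional_coset_power //; last first.
    by move: en; rewrite !big_ord_recl big_ord0 addn0 ord1E.
  rewrite !big_ord_recl big_ord0 ord1E mulr1 !rmorphXn !rmorphM !fmorphV /=.
  by rewrite !rmorph_int !rmorph_nat.
rewrite -(mask_aniso_functional f g aL ma).
rewrite [LHS]fsbig_seq ?fset_uniq // [RHS]fsbig_seq ?fset_uniq //.
(* [P] and [Q] index the possibly nonzero terms on either side; [h] maps [P] onto
   [Q] bijectively. *)
pose h ga := al - dilation m *m ga.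
pose P := [set ga | h ga \in box L].
pose Q := [set s : 'cV[int]_2 | [/\ s \in box L, (2%:Z %| (al 0 0 - s 0 0)%R)%Z
                                   & (m%:Z %| (al 1 0 - s 1 0)%R)%Z]].
rewrite -(fsbig_widen P); last 2 first.
- move=> ga; apply: contraTT => gaG; rewrite /P /= /h -[dilation m]expr1.
  exact: dilate_notin_box gaG.
- by move=> ga [_ /negP gaL]; rewrite /= (aL _ gaL) mul0r.
rewrite -[RHS](fsbig_widen Q); last 2 first.
- by move=> s [].
- move=> s [/= sL sQ]; rewrite /f /g /coset_power.
  case: ifP => d2; last by rewrite mulr0 mul0r.
  by case: ifP => dm; [case: sQ | rewrite mulr0].
rewrite [RHS](reindex_fsbig h P Q); last first.
  split.
  - move=> ga /= gaL; split => //; rewrite sub_dilationE opprB addrC subrK.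
      exact: dvdz_mulr.
    exact: dvdz_mulr.
  - move=> x y _ _ /subrI xy; apply/colP => i.
    have := congr1 (fun v : 'cV_2 => v i 0) xy.
    rewrite !dilationE => /mulfI; apply.
    by rewrite eqz_nat -lt0n axis_dilation_gt0.
  - move=> s [sL /dvdzP[q0 h0] /dvdzP[q1 h1]].
    pose ga : 'cV[int]_2 := \col_i if i == 0 then q0 else q1.
    have hs : h ga = s.
      apply/colP => i; rewrite sub_dilationE mxE /axis_dilation.
      case: i => -[|[|//]] i2 /=.
        have -> : Ordinal i2 = 0 by apply: val_inj.
        by rewrite mulrC -h0; ring.
      have -> : Ordinal i2 = 1 by apply: val_inj.
      by rewrite mulrC -h1; ring.
    by exists ga => //; rewrite /P /= hs.
apply: eq_fsbigr => ga _; rewrite /f /g /coset_power !sub_dilationE.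
rewrite !opprB ![al _ _ + _]addrC !subrK !dvdz_mulr // !mulKz //;
  last by rewrite eqz_nat -lt0n.
rewrite !big_ord_recl big_ord0 ord1E mulr1 !rmorphM !rmorphXn /=.
by rewrite !rmorph_int mulrA.
Qed.


(** * Iterates of the scheme *)

Definition cascade (R : realType) (m : nat) (a : 'cV[int]_2 -> R) (k : nat) :
  'cV[int]_2 -> R := iter k (subdivision (dilation m) a) (@delta_seq R).

(** A shift by [M ^ k.+1 be] after the last step is a shift by [M ^ k be]
    before it; the mask factor no longer depends on [be]. *)
Lemma cascadeS_shift (R : realType) (m : nat) (a : 'cV[int]_2 -> R) (k : nat)
    (al be : 'cV[int]_2) :
  cascade m a k.+1 (al - dilation m ^+ k.+1 *m be)
  = \sum_(ga \in [set: 'cV[int]_2])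
      a (al - dilation m *m ga) * cascade m a k (ga - dilation m ^+ k *m be).
Proof.
rewrite /cascade iterS {1}/subdivision.
rewrite (reindex_fsbigT (fun ga => ga - dilation m ^+ k *m be)) //=; last first.
  by exists (fun ga => ga + dilation m ^+ k *m be) => ga; rewrite ?addrK ?subrK.
apply: eq_fsbigr => ga _; congr (a _ * _).
rewrite mulmxBr mulmxA.
rewrite (_ : dilation m *m dilation m ^+ k = dilation m ^+ k.+1) ?exprS //.
by rewrite opprB addrA subrK.
Qed.

(** Rescaled by [M ^ -k] the supports stay in one box: a step enlarges a
    coordinate bound [B] to at most [d B + L], and [d >= 2] keeps it at most
    [L (d ^ k - 1)] after [k] steps.  The term [L] is put on the left
    to avoid truncated subtraction. *)
Lemma cascade_support (R : realType) (m L : nat) (a : 'cV[int]_2 -> R) (k : nat)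
    (v : 'cV[int]_2) (i : 'I_2) :
  (1 < m)%N -> supported_in L a -> cascade m a k v != 0 ->
  (`|(v i 0)%R| + L <= L * axis_dilation m i ^ k)%N.
Proof.
move=> m1 aL; elim: k v => [|k IH] v.
  rewrite /cascade /= /delta_seq.
  case: (eqVneq v 0) => [-> _|_]; last by rewrite eqxx.
  by rewrite mxE muln1.
rewrite /cascade iterS {1}/subdivision.
move=> /(@fsbigN1 _ _ _ _ _ _ (fun v ga => a (v - _ *m ga) * _ ga) v)[ga _].
rewrite mulf_eq0 negb_or => /andP[aga /IH pga].
have /in_box/(_ i) : v - dilation m *m ga \in box L.
  by apply: contraNT aga => /aL ->.
rewrite sub_dilationE.
have := axis_dilation_gt1 i m1.
move: pga; rewrite expnS; set d := axis_dilation m i; set D := (d ^ k)%N.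
move: (v i 0) (ga i 0) => x y.
move=> h1 d1 h2.
have h3 : (`|x| <= `|(x - d%:Z * y)%R| + d * `|y|)%N.
  by rewrite -[X in (_ + X * _)%N]/(`|d%:Z|%N) -abszM; lia.
have h4 : (d * (`|y| + L) <= d * (L * D))%N by rewrite leq_mul2l h1 orbT.
rewrite mulnCA; apply: leq_trans h4; rewrite mulnDr.
have : (L * 2 <= d * L)%N by rewrite mulnC leq_mul2r d1 orbT.
by lia.
Qed.

Lemma cascade_supported_in (R : realType) (m L : nat)
    (a : 'cV[int]_2 -> R) (k : nat) :
  (1 < m)%N -> supported_in L a ->
  supported_in (\sum_i L * axis_dilation m i ^ k) (cascade m a k).
Proof.
move=> m1 aL v; apply: contraNeq => pv; apply/in_box => i.
apply: leq_trans (leq_trans (leq_addr L _) (cascade_support i m1 aL pv)) _.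
by rewrite (bigD1 i) //= leq_addr.
Qed.

(** This is the statement that [k] steps reproduce monomials, with the iterate of
    polynomial data expanded as a superposition of shifted iterates of the delta
    sequence; convergence only speaks about bounded data such as the latter.
    In the induction step the last application of the mask sees the samples of
    the monomial on [M ^ -k Z^2], which is a constant multiple of the monomial
    on the lattice. *)
Lemma cascade_reproduces_monomial (R : realType) (m n : nat)
    (a : 'cV[int]_2 -> R) (e : 'I_2 -> nat) (k : nat) (al : 'cV[int]_2) :
  (1 < m)%N -> is_mask_of (@aniso_symbol (complex R) m n) a ->
  (\sum_i e i < 2 * n)%N ->
  \sum_(be \in [set: 'cV[int]_2])
      cascade m a k (al - dilation m ^+ k *m be)
      * \prod_i ((be i 0)%:~R : R) ^+ e i
  = \prod_i (param R (dilation m) k al i 0) ^+ e i.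
Proof.
move=> m1 ma en; have m0 := ltnW m1.
have [L aL] := finitely_supported_in_box (proj1 ma).
under eq_bigr do rewrite paramE //.
elim: k al => [|k IH] al.
  rewrite (fsbigTE [fset al]%fset) => [|be].
    rewrite big_seq_fset1 expr0 mul1mx subrr /cascade /= /delta_seq eqxx mul1r.
    by apply: eq_bigr => i _; rewrite expr0 divr1.
  rewrite inE expr0 mul1mx /cascade /= /delta_seq subr_eq0 eq_sym => /negPf ->.
  by rewrite mul0r.
pose Lk := (\sum_i L * axis_dilation m i ^ k)%N.
have pL : supported_in Lk (cascade m a k) by exact: cascade_supported_in.
(* [G] holds the [ga] that can contribute, and [B] the [be] that can contribute
   for some [ga] in [G]; with both ranges fixed and finite, the sums can be
   exchanged. *)
pose G := box (l1norm al + L).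
have aG ga : ga \notin G -> a (al - dilation m *m ga) = 0.
  move=> gaG; apply: aL; rewrite -[dilation m]expr1.
  exact: dilate_notin_box gaG.
pose B := box (\sum_(ga <- G) l1norm ga + Lk).
have pB be ga : ga \in G -> be \notin B ->
    cascade m a k (ga - dilation m ^+ k *m be) = 0.
  move=> gaG beB; apply: pL; apply: dilate_notin_box beB => //.
  by rewrite leq_add2r (bigD1_seq ga) ?fset_uniq //= leq_addr.
have pS be : cascade m a k.+1 (al - dilation m ^+ k.+1 *m be) =
    \sum_(ga <- G) a (al - dilation m *m ga)
                    * cascade m a k (ga - dilation m ^+ k *m be).
  by rewrite cascadeS_shift; apply: fsbigTE => ga /aG ->; rewrite mul0r.
rewrite (fsbigTE B) => [|be beB]; last first.
  by rewrite pS big_seq big1 ?mul0r // => ga gaG; rewrite (pB be) ?mulr0.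
under eq_bigr => be _ do rewrite pS mulr_suml.
rewrite exchange_big /=.
transitivity (\sum_(ga <- G) a (al - dilation m *m ga) *
    \prod_i ((ga i 0)%:~R / (axis_dilation m i)%:R ^+ k : R) ^+ e i).
  rewrite !big_seq; apply: eq_bigr => ga gaG.
  rewrite -IH (fsbigTE B) => [|be /(pB _ _ gaG) ->]; last by rewrite mul0r.
  by rewrite mulr_sumr; apply: eq_bigr => be _; rewrite mulrA.
pose c : R := \prod_i ((axis_dilation m i)%:R ^+ k)^-1 ^+ e i.
transitivity (\sum_(ga <- G)
    (a (al - dilation m *m ga) * \prod_i ((ga i 0)%:~R : R) ^+ e i) * c).
  apply: eq_bigr => ga _; rewrite -mulrA -big_split /=; congr (_ * _).
  by apply: eq_bigr => i _; rewrite exprMn.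
rewrite -mulr_suml -fsbigTE; last by move=> ga /aG ->; rewrite mul0r.
rewrite (mask_reproduces _ m0 ma en) -big_split /=; apply: eq_bigr => i _.
by rewrite -exprMn exprS invfM mulrA.
Qed.

Lemma cascade_reproduces (R : realType) (m n : nat) (a : 'cV[int]_2 -> R)
    (q : mpoly.mpoly 2 R) (k N : nat) (al : 'cV[int]_2) :
  (1 < m)%N -> is_mask_of (@aniso_symbol (complex R) m n) a ->
  (mpoly.msize q <= 2 * n)%N ->
  (forall be, be \notin box N ->
     cascade m a k (al - dilation m ^+ k *m be) = 0) ->
  \sum_(be <- box N) cascade m a k (al - dilation m ^+ k *m be)
      * mpoly.meval (fun i => (be i 0)%:~R) q
  = mpoly.meval (fun i => param R (dilation m) k al i 0) q.
Proof.
move=> m1 ma qn pN; rewrite mpoly.mevalE.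
under eq_bigr do rewrite mpoly.mevalE mulr_sumr.
rewrite exchange_big /= !big_seq; apply: eq_bigr => e eq.
rewrite -(cascade_reproduces_monomial _ _ m1 ma); last first.
  by rewrite -mpoly.mdegE; apply: leq_trans qn; apply: mpoly.msize_mdeg_lt.
rewrite (fsbigTE (box N)) => [|be /pN ->]; last by rewrite mul0r.
by rewrite mulr_sumr; apply: eq_bigr => be _; rewrite mulrCA.
Qed.


(** * Passage to the limit *)

Lemma cvg_col (R : realType) (p : nat) (T : Type) (F : set_system T)
    (FF : Filter F) (f : T -> 'cV[R]_p) (l : 'cV[R]_p) :
  (forall i, f t i 0 @[t --> F] --> l i 0) -> f @ F --> l.
Proof.
move=> fl A [P lP PA].
have := @filter_forall _ _ (fun i t => P i 0 (f t i 0)) _ FF.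
move=> /(_ (fun i => fl i _ (lP i 0))); apply: filterS => t Pt.
by apply: PA => i j; rewrite (ord1 j).
Qed.

Lemma unif_continuous_cvg (U V : uniformType) (f : U -> V) (T : Type)
    (F : set_system T) (FF : Filter F) (g : T -> U) (l : U) :
  unif_continuous f -> g @ F --> l -> f (g t) @[t --> F] --> f l.
Proof.
move=> fu gl; apply: (cvg_comp _ _ gl).
move=> A /=; rewrite -!nbhs_entourageE /= => -[E entE EA].
exists [set xy | E (f xy.1, f xy.2)]; first exact: fu.
by move=> y /xsectionP Ey; apply/EA/xsectionP.
Qed.

(** The points [M ^ -k (al k - M ^ k be) = M ^ -k (al k) - be] tend to [x - be];
    the uniform error bound of convergence compares the iterate with [phi] at
    these points, and [phi] is continuous. *)
Lemma cascade_cvg (R : realType) (m : nat) (a : 'cV[int]_2 -> R)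
    (phi : 'cV[R]_2 -> R) (al : nat -> 'cV[int]_2) (x : 'cV[R]_2)
    (be : 'cV[int]_2) :
  (0 < m)%N -> is_limit_function (dilation m) a (@delta_seq R) phi ->
  param R (dilation m) k (al k) @[k --> \oo] --> x ->
  cascade m a k (al k - dilation m ^+ k *m be) @[k --> \oo]
    --> phi (x - map_mx intr be).
Proof.
move=> m0 [phiU sup0] alx.
pose al' k := al k - dilation m ^+ k *m be.
have al'x : phi (param R (dilation m) k (al' k)) @[k --> \oo]
              --> phi (x - map_mx intr be).
  apply: unif_continuous_cvg => //.
  rewrite (_ : (fun k => _) =
    (fun k => param R (dilation m) k (al k) - map_mx intr be)).
    by apply: cvgB => //; exact: cvg_cst.
  apply/funext => k; apply/colP => i.
  rewrite [RHS]mxE [X in _ = _ + X]mxE [X in _ = _ - X]mxE.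
  rewrite !paramE // /al' sub_dilation_expE rmorphB rmorphM rmorphXn /= -pmulrn.
  rewrite mulrBl [X in _ - X = _]mulrAC mulfV ?mul1r //.
  by rewrite expf_neq0 // pnatr_eq0 -lt0n axis_dilation_gt0.
pose err k := phi (param R (dilation m) k (al' k)) - cascade m a k (al' k).
have err0 : err k @[k --> \oo] --> (0 : R).
  apply/norm_cvg0P.
  suff /fine_cvgP[_ //] : (`|err k|)%:E @[k --> \oo] --> (0 : R)%:E.
  apply: (squeeze_cvge _ (cvg_cst _) sup0); apply: nearW => k.
  rewrite lee_fin normr_ge0 /=; apply: ereal_sup_ubound.
  by exists (al' k).
rewrite -[phi _]subr0 (_ : (fun k => _) =
  (fun k => phi (param R (dilation m) k (al' k)) - err k)); first exact: cvgB.
by apply/funext => k; rewrite /err opprB [RHS]addrC subrK.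
Qed.

Lemma floor_grid_cvg (R : realType) (d : nat) (x : R) :
  (1 < d)%N ->
  (Num.floor (d%:R ^+ k * x))%:~R / d%:R ^+ k @[k --> \oo] --> x.
Proof.
move=> d1; have d0 k : 0 < d%:R ^+ k :> R by rewrite exprn_gt0 // ltr0n ltnW.
apply: (@squeeze_cvgr _ _ _ _ (fun k => x - (d%:R^-1) ^+ k) (fun k => x)).
- apply: nearW => k; have /andP[h1 h2] := floor_itv (d%:R ^+ k * x).
  rewrite ler_pdivlMr // ler_pdivrMr // mulrBl exprVn mulVf ?gt_eqF //.
  rewrite [x * _]mulrC h1 andbT.
  by rewrite lerBlDr -[1]/(1%:~R) -rmorphD /= ltW.
- rewrite -[X in _ --> X]subr0; apply: cvgB; first exact: cvg_cst.
  apply: cvg_expr; rewrite ger0_norm ?invr_ge0 //.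
  by rewrite invf_lt1 ?ltr1n // ltr0n ltnW.
- exact: cvg_cst.
Qed.

(** The box of relevant shifts does not depend on [k]: both the support of the
    iterate and the rounding error of the grid point scale down by [d ^ k], to at
    most [L] and [1].  The second unit covers the truncation of the norm. *)
Lemma cascade_floor_support (R : realType) (m L : nat) (a : 'cV[int]_2 -> R)
    (x : 'cV[R]_2) (k : nat) (be : 'cV[int]_2) :
  (1 < m)%N -> supported_in L a ->
  be \notin box (\sum_i Num.truncn `|(x i 0)%R|%R + 2 + L) ->
  cascade m a k (\col_i Num.floor ((axis_dilation m i)%:R ^+ k * x i 0)
                 - dilation m ^+ k *m be) = 0.
Proof.
move=> m1 aL; apply: contraNeq => pk; apply/in_box => i.
have := cascade_support i m1 aL pk; rewrite sub_dilation_expE mxE => h.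
have xi : (Num.truncn `|(x i 0)%R|%R <= \sum_i Num.truncn `|(x i 0)%R|%R)%N.
  by rewrite (bigD1 i) //= leq_addr.
apply: (@leq_trans (Num.truncn `|(x i 0)%R|%R + 2 + L));
  last by rewrite !leq_add2r.
have := axis_dilation_gt0 i (ltnW m1).
move: h; set d := axis_dilation m i; set t := Num.floor _ => h d0.
have D0 : 0 < d%:R ^+ k :> R by rewrite exprn_gt0 // ltr0n.
have /andP[t1 t2] := floor_itv (d%:R ^+ k * x i 0).
have x2 : `|x i 0| < (Num.truncn `|(x i 0)%R|%R).+1%:R by exact: truncnS_gt.
set D : R := d%:R ^+ k in D0 t1 t2 *; set y := be i 0 in h *.
have D1 : 1 <= D by rewrite exprn_ege1 // ler1n.
have hR : `|t%:~R - D * y%:~R| + L%:R <= L%:R * D.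
  move: h; rewrite -(ler_nat R) natrD natrM natrX natr_absz intr_norm.
  by rewrite rmorphB rmorphM rmorphXn /= -!pmulrn.
have tR : `|t%:~R| <= D * `|x i 0| + 1.
  rewrite -[D in D * _]ger0_norm ?(ltW D0) // -normrM.
  have : D * x i 0 < t%:~R + 1 by move: t2; rewrite rmorphD.
  move: t1; case: (ger0P (D * x i 0)) => ? ? ?;
    by rewrite ler_norml; apply/andP; split; lra.
have yR : D * `|y%:~R| <= `|t%:~R| + `|t%:~R - D * y%:~R|.
  rewrite -[D in D * _]ger0_norm ?(ltW D0) // -normrM.
  by rewrite -{1}[D * _](subKr t%:~R) ler_normB.
have yB : `|y%:~R| < (Num.truncn `|x i 0|).+1%:R + 1 + L%:R :> R.
  have x3 : D * `|x i 0| < D * (Num.truncn `|(x i 0)%R|%R).+1%:R.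
    by rewrite ltr_pM2l.
  rewrite -(ltr_pM2l D0) !mulrDr mulr1 [D * L%:R]mulrC.
  have := ler0n R L; lra.
rewrite -(ler_nat R) natr_absz intr_norm !natrD; apply/ltW/(lt_le_trans yB).
by rewrite -addn1 natrD; lra.
Qed.

Theorem proposition3p4 (R : realType) (m n : nat)
    (hm : (3 <= m)%N) (hodd : odd m) (hn : (1 <= n)%N)
    (a : 'cV[int]_2 -> R)
    (ha : is_mask_of (@aniso_symbol (complex R) m n) a)
    (hconv : convergent (dilation m) a) :
  reproduces_polynomials (dilation m) a (2 * n - 1)%N.
Proof.
have m1 : (1 < m)%N by apply: ltn_trans hm.
have m0 : (0 < m)%N by apply: ltn_trans hm.
have lim : is_limit_function (dilation m) a (@delta_seq R)
             (basic_limit_function (dilation m) a).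
  apply: (xgetPex (fun=> 0)
    (P := [set F | is_limit_function (dilation m) a (@delta_seq R) F])).
  apply: hconv; exists 1 => al.
  by rewrite /delta_seq; case: eqP; rewrite ?normr1 ?normr0.
set phi := basic_limit_function _ _ in lim *.
have [L aL] := finitely_supported_in_box (proj1 ha).
rewrite /reproduces_polynomials -/phi => q qn x.
pose al k : 'cV[int]_2 := \col_i Num.floor ((axis_dilation m i)%:R ^+ k * x i 0).
have alx i : param R (dilation m) k (al k) i 0 @[k --> \oo] --> x i 0.
  under eq_cvg do rewrite paramE // mxE.
  exact/floor_grid_cvg/axis_dilation_gt1.
have alX : param R (dilation m) k (al k) @[k --> \oo] --> x by exact: cvg_col.
pose N := (\sum_i Num.truncn `|(x i 0)%R|%R + 2 + L)%N.
(* The compact support of [phi], in the form needed for the sum at [x]. *)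
have phi0 be : be \notin box N -> phi (x - map_mx intr be) = 0.
  move=> beN.
  have c0 : cascade m a k (al k - dilation m ^+ k *m be) @[k --> \oo]
              --> (0 : R).
    under eq_cvg do rewrite (cascade_floor_support _ m1 aL beN).
    exact: cvg_cst.
  exact: (cvg_unique (@Rhausdorff R) (cascade_cvg m0 lim alX) c0).
rewrite (fsbigTE (box N)) => [|be /phi0 ->]; last by rewrite mulr0.
have lhs : \sum_(be <- box N) cascade m a k (al k - dilation m ^+ k *m be)
      * mpoly.meval (fun i => (be i 0)%:~R) q @[k --> \oo] -->
   \sum_(be <- box N) mpoly.meval (fun i => (be i 0)%:~R) q
      * phi (x - map_mx intr be).
  apply: cvg_big => [|be _]; first exact: add_continuous.
  rewrite [X in _ --> X]mulrC; apply: cvgM; last exact: cvg_cst.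
  exact: cascade_cvg.
have rhs : \sum_(be <- box N) cascade m a k (al k - dilation m ^+ k *m be)
      * mpoly.meval (fun i => (be i 0)%:~R) q @[k --> \oo] -->
   mpoly.meval (fun i => x i 0) q.
  have reprod k :
      \sum_(be <- box N) cascade m a k (al k - dilation m ^+ k *m be)
      * mpoly.meval (fun i => (be i 0)%:~R) q
      = mpoly.meval (fun i => param R (dilation m) k (al k) i 0) q.
    apply: (cascade_reproduces m1 ha); first by apply: leq_trans qn _; lia.
    by move=> be beN; exact: cascade_floor_support beN.
  rewrite mpoly.mevalE; under eq_cvg do rewrite reprod mpoly.mevalE.
  apply: cvg_big => [|e _]; first exact: add_continuous.
  apply: cvgM; first exact: cvg_cst.
  apply: cvg_big => [|i _]; first exact: mul_continuous.
  apply: (@cvg_comp _ _ _ _ (fun t : R => t ^+ _) _ _ _ (alx i)).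
  exact: exprn_continuous.
exact: (cvg_unique (@Rhausdorff R) lhs rhs).
Qed.
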